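(* Let $n\le r$, let $s=\gcd(n,r)$, and write $n=xs$, $r=ys$, with $x$ and $y$ both odd. Then the center of the quasi-Laurent polynomial algebra generated by the $nr$ quantum minors $\xi_{\alpha,j}\in\mathcal O_q(M(n,r))$ is generated by the following $s$ elements (and their inverses), where $\xi_{0,r}:=1$: $$\prod_{\ell=0}^{y-1}(\xi_{n,\,i+\ell s})^{(-1)^\ell}\prod_{k=0}^{x-1}(\xi_{n-i-ks,\,r})^{(-1)^{k+1}},\qquad i=1,\dots,s.$$
   Context: Let $n,r$ be positive integers and $q\in\mathbb C\setminus\{0\}$ not a root of unity. $\mathcal O_q(M(n,r))$ (the FRT algebra) is the $\mathbb C$-algebra generated by $Z_{\alpha j}$ ($1\le\alpha\le n$, $1\le j\le r$) with relations: $Z_{\alpha j}Z_{\alpha k}=qZ_{\alpha k}Z_{\alpha j}$ ($j<k$); $Z_{\alpha j}Z_{\beta j}=qZ_{\beta j}Z_{\alpha j}$ ($\alpha<\beta$); $Z_{\alpha j}Z_{\beta l}=Z_{\beta l}Z_{\alpha j}$ ($\alpha>\beta,\ j<l$); $Z_{\alpha j}Z_{\beta l}=Z_{\beta l}Z_{\alpha j}+(q-q^{-1})Z_{\alpha l}Z_{\beta j}$ ($\alpha<\beta,\ j<l$). For $\boldsymbol\alpha=\{\alpha_1<\dots<\alpha_m\}$, $\mathbf j=\{j_1<\dots<j_m\}$ let $\xi^{\boldsymbol\alpha}_{\mathbf j}=\sum_{\sigma\in S_m}(-q)^{\ell(\sigma)}Z_{\alpha_1,j_{\sigma(1)}}\cdots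 Z_{\alpha_m,j_{\sigma(m)}}$. Put $\xi_{\alpha,j}=\xi^{\{\alpha-j+1,\dots,\alpha\}}_{\{1,\dots,j\}}$ if $\alpha\ge j$ and $\xi_{\alpha,j}=\xi^{\{1,\dots,\alpha\}}_{\{j-\alpha+1,\dots,j\}}$ if $\alpha<j$. These $nr$ elements satisfy $\xi_{\alpha,j}\xi_{\beta,k}=q^{\Lambda_{\alpha j,\beta k}}\xi_{\beta,k}\xi_{\alpha,j}$ with $\Lambda=\mathbb T^tH_S\mathbb T$. Here $H_S$ is the $nr\times nr$ matrix of $n\times n$ blocks of size $r\times r$ with all diagonal blocks equal to the skew-symmetric matrix with all entries above the diagonal $1$, blocks $\mathbb I$ above and $-\mathbb I$ below the block diagonal; and $\mathbb T$ is block upper triangular with $(\alpha,\beta)$ block $T^{\beta-\alpha}$ for $\alpha\le\beta$, $T=\sum_{i=1}^{r-1}E_{i,i+1}$. The quasi-Laurent polynomial algebra generated by the $\xi_{\alpha,j}$ is the algebra generated by the $\xi_{\alpha,j}^{\pm1}$ subject to these $q$-commutation relations. The order of factors in a monomial only affects it by a power of $q$. *)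

(* Defs.v *)
From HB Require Import structures.
From mathcomp Require Import all_boot all_order all_algebra all_fingroup.
From mathcomp Require Export complex reals.

Set Implicit Arguments.
Unset Strict Implicit.
Unset Printing Implicit Defensive.

Import GRing.Theory.
Local Open Scope ring_scope.

Definition central (A : pzRingType) (a : A) : Prop :=
  forall b : A, a * b = b * a.

Inductive gen_subalg (F : fieldType) (A : algType F) (S : A -> Prop) :
    A -> Prop :=
| GenIn a : S a -> gen_subalg S a
| GenOne : gen_subalg S 1
| GenAdd a b : gen_subalg S a -> gen_subalg S b -> gen_subalg S (a + b)
| GenMul a b : gen_subalg S a -> gen_subalg S b -> gen_subalg S (a * b)
| GenScale (c : F) a : gen_subalg S a -> gen_subalg S (c *: a).

(* The algebra generated by a family indexed by [G] subject to the relations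
   [rel], characterised up to isomorphism by its universal property.  [rel B h]
   says that the family [h] of elements of [B] satisfies the relations. *)
Definition presented (F : fieldType) (G : Type)
    (rel : forall B : algType F, (G -> B) -> Prop)
    (A : algType F) (g : G -> A) : Prop :=
  rel A g /\
  forall (B : algType F) (h : G -> B), rel B h ->
    (exists f : {lrmorphism A -> B}, forall i, f (g i) = h i) /\
    (forall f f' : {lrmorphism A -> B},
       (forall i, f (g i) = h i) -> (forall i, f' (g i) = h i) -> f =1 f').

(* In a family indexed by ['I_n * 'I_r], the pair [(a, j)] of ordinals stands
   for the index (a + 1, j + 1) of the mathematical notation.  [entry] accesses
   a family with the usual 1-based indices; it is 1 outside the range, which in
   particular gives the convention xi_{0,r} = 1. *)
Definition entry (n r : nat) (A : pzRingType) (v : 'I_n * 'I_r -> A)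
    (a j : nat) : A :=
  match a, j with
  | a'.+1, j'.+1 =>
      match insub a' : option 'I_n, insub j' : option 'I_r with
      | Some a0, Some j0 => v (a0, j0)
      | _, _ => 1
      end
  | _, _ => 1
  end.

Definition FRT_rel (F : fieldType) (q : F) (n r : nat) (B : algType F)
    (Z : 'I_n * 'I_r -> B) : Prop :=
  [/\ forall (a : 'I_n) (j k : 'I_r), (j < k)%N ->
        Z (a, j) * Z (a, k) = q *: (Z (a, k) * Z (a, j)),
      forall (a b : 'I_n) (j : 'I_r), (a < b)%N ->
        Z (a, j) * Z (b, j) = q *: (Z (b, j) * Z (a, j)),
      forall (a b : 'I_n) (j l : 'I_r), (b < a)%N -> (j < l)%N ->
        Z (a, j) * Z (b, l) = Z (b, l) * Z (a, j)
    & forall (a b : 'I_n) (j l : 'I_r), (a < b)%N -> (j < l)%N ->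
        Z (a, j) * Z (b, l) =
        Z (b, l) * Z (a, j) + (q - q^-1) *: (Z (a, l) * Z (b, j))].

Definition is_FRT (F : fieldType) (q : F) (n r : nat) (O : algType F)
    (Z : 'I_n * 'I_r -> O) : Prop :=
  presented (@FRT_rel F q n r) Z.

Definition perm_length (m : nat) (s : 'S_m) : nat :=
  #|[set p : 'I_m * 'I_m | (p.1 < p.2)%N && (s p.2 < s p.1)%N]|.

(* Row and column sets are given by their increasing enumerations (with 1-based
   indices), assumed to have the same size. *)
Definition qminor (F : fieldType) (q : F) (n r : nat) (O : algType F)
    (Z : 'I_n * 'I_r -> O) (rows cols : seq nat) : O :=
  \sum_(s : 'S_(size rows)) (- q) ^+ perm_length s *:
    \prod_(i < size rows) entry Z (nth 0%N rows i) (nth 0%N cols (s i)).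

Definition xi (F : fieldType) (q : F) (n r : nat) (O : algType F)
    (Z : 'I_n * 'I_r -> O) (p : 'I_n * 'I_r) : O :=
  let a := p.1.+1 in let j := p.2.+1 in
  if (j <= a)%N then qminor q Z (iota (a - j + 1) j) (iota 1 j)
  else qminor q Z (iota 1 a) (iota (j - a + 1) a).

Definition shift_mx (r : nat) : 'M[int]_r :=
  \matrix_(i, j) (j == i.+1 :> nat)%:R.

Definition skew_mx (r : nat) : 'M[int]_r :=
  \matrix_(i, j) ((i < j)%N%:R - (j < i)%N%:R).

Definition HS_mx (n r : nat) : 'M[int]_(\sum_(a < n) r) :=
  \mxblock_(a < n, b < n)
    (if a == b then skew_mx r else if (a < b)%N then 1%:M else - 1%:M).

Definition TT_mx (n r : nat) : 'M[int]_(\sum_(a < n) r) :=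
  \mxblock_(a < n, b < n)
    (if (a <= b)%N then shift_mx r ^+ (b - a) else 0).

Definition Lambda_mx (n r : nat) : 'M[int]_(\sum_(a < n) r) :=
  (TT_mx n r)^T *m HS_mx n r *m TT_mx n r.

(* [submxblock M a b] is the (a, b) block of [M]. *)
Definition Lambda (n r : nat) (s t : 'I_n * 'I_r) : int :=
  submxblock (Lambda_mx n r) s.1 t.1 s.2 t.2.

Definition q_commuting (F : fieldType) (q : F) (I : Type) (L : I -> I -> int)
    (B : algType F) (v : I -> B) : Prop :=
  forall s t, v s * v t = q ^ L s t *: (v t * v s).

(* Relations on generators [inl s] and [inr s], which stand for the s-th
   variable and its inverse. *)
Definition laurent_rel (F : fieldType) (q : F) (I : Type) (L : I -> I -> int)
    (B : algType F) (h : I + I -> B) : Prop :=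
  (forall s, h (inl s) * h (inr s) = 1 /\ h (inr s) * h (inl s) = 1) /\
  q_commuting q L (fun s => h (inl s)).

Definition laurent_gen (I : Type) (A : unitRingType) (u : I -> A)
    (g : I + I) : A :=
  match g with inl s => u s | inr s => (u s)^-1 end.

(* [A] is the quasi-Laurent polynomial algebra generated by the family [v] of
   elements of [O], which q-commute with exponents [L]; [u s] is the generator
   of [A] attached to [v s].  Taking [A] in [unitAlgType] is no restriction: it
   only lets us write the inverses and integer powers of the generators. *)
Record quasi_Laurent (F : fieldType) (q : F) (I : Type) (L : I -> I -> int)
    (O : algType F) (v : I -> O) (A : unitAlgType F) (u : I -> A) : Prop := {
  quasi_Laurent_comm : q_commuting q L v;
  quasi_Laurent_pres : presented (@laurent_rel F q I L) (laurent_gen u)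
}.

Definition center_gen (F : fieldType) (n r s x y : nat) (A : unitAlgType F)
    (u : 'I_n * 'I_r -> A) (i : nat) : A :=
  (\prod_(0 <= l < y) entry u n (i + l * s) ^ ((-1) ^+ l : int)) *
  (\prod_(0 <= k < x) entry u (n - i - k * s) r ^ ((-1) ^+ k.+1 : int)).

(* Main.v *)
From HB Require Import structures.
Require Import Defs.
From mathcomp Require Import all_boot all_order all_algebra.
From mathcomp Require Import complex reals boolp zify ring lra.

Set Implicit Arguments.
Unset Strict Implicit.
Unset Printing Implicit Defensive.

Import Order.TTheory GRing.Theory Num.Theory.
Local Open Scope ring_scope.

(* An element commuting with every generator [u s] is a combination of monomials
   of weight 0, i.e. whose exponent vectors m satisfy Lambda m = 0: eigenvectors
   of conjugation by [u s] for distinct powers of q are separated because q is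
   not a root of unity.  As TT is unimodular, Lambda m = 0 iff HS v = 0 where
   v = TT m.  Extend v to a function f on nat * nat with f(a + n, j) = f(a, j + r)
   = - f(a, j).  The entries of HS v are then sums of f over two windows, and
   their mixed second difference is 2 (f(a, j) - f(a + 1, j + 1)), so HS v = 0 iff
   f is constant along diagonals.  For x and y odd, Bezout turns the two
   antiperiods into the single one f(a, j + s) = - f(a, j).  Finally
   m(a, j) = v(a, j) - v(a + 1, j + 1) lives on the last row and the last column,
   where it is the combination of the exponents of the central elements with
   coefficients f(n - 1, i). *)

(** * Subalgebras and the universal property *)

(* [S] itself, tagged with its closure proof so that instances can be keyed on it. *)
Definition subalg_pred (F : fieldType) (A : algType F) (S : {pred A})
  (clS : subalg_closed S) : {pred A} := S.

HB.instance Definition _ (F : fieldType) (A : algType F) (S : {pred A})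
    (clS : subalg_closed S) :=
  GRing.isSubalgClosed.Build F A (subalg_pred clS) (GRing.subalg_closed_semi clS).

Record subalg (F : fieldType) (A : algType F) (S : {pred A})
  (clS : subalg_closed S) :=
  Subalg { subalg_val :> A; _ : subalg_val \in subalg_pred clS }.

HB.instance Definition _ (F : fieldType) (A : algType F) (S : {pred A})
  (clS : subalg_closed S) := [isSub for @subalg_val F A S clS].
HB.instance Definition _ (F : fieldType) (A : algType F) (S : {pred A})
  (clS : subalg_closed S) := [Choice of subalg clS by <:].
HB.instance Definition _ (F : fieldType) (A : algType F) (S : {pred A})
  (clS : subalg_closed S) := [SubChoice_isSubAlgebra of subalg clS by <:].

HB.instance Definition _ (F : fieldType) (A : algType F) (S : {pred A})
  (clS : subalg_closed S) :=
  GRing.RMorphism.copy (@subalg_val F A S clS) (val : subalg clS -> A).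
HB.instance Definition _ (F : fieldType) (A : algType F) (S : {pred A})
  (clS : subalg_closed S) :=
  GRing.Linear.copy (@subalg_val F A S clS) (val : subalg clS -> A).
(** The relations descend to [S] because the inclusion is injective. The universal property then
    gives a morphism from [A] to [S], and its composite with the inclusion fixes the generators,
    hence is the identity by uniqueness. *)
Lemma presented_subalg_full (F : fieldType) (G : Type)
    (rel : forall B : algType F, (G -> B) -> Prop) (A : algType F) (g : G -> A)
    (S : {pred A}) :
  (forall (B : algType F) (f : {lrmorphism B -> A}) (h : G -> B),
     injective f -> rel A (f \o h) -> rel B h) ->
  presented rel g -> subalg_closed S -> (forall i, g i \in S) ->
  forall a, a \in S.
Proof.
move=> rel_inj [relg univ] clS gS a.
pose h i : subalg clS := Subalg (gS i : g i \in subalg_pred clS).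
pose incl : {lrmorphism subalg clS -> A} := @subalg_val F A S clS.
have relh : rel _ h by apply: (rel_inj _ incl) => //; exact: val_inj.
have [[f fg] _] := univ _ h relh.
have [_ uniq] := univ _ g relg.
have <- : incl (f a) = a.
  by apply: (uniq (incl \o f) idfun) => // i /=; rewrite fg.
exact: valP.
Qed.

Lemma laurent_rel_inj (F : fieldType) (q : F) (I : Type) (L : I -> I -> int)
    (A B : algType F) (f : {lrmorphism B -> A}) (h : I + I -> B) :
  injective f -> laurent_rel q L (f \o h) -> laurent_rel q L h.
Proof.
move=> f_inj [hV hL]; split=> [s|s t].
  by have [h1 h2] := hV s; split; apply: f_inj; rewrite rmorphM rmorph1.
by apply: f_inj; rewrite linearZ /= !rmorphM; exact: hL.
Qed.

(** * Quasi-commuting monomials *)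

Section QuasiCommutation.
Variables (F : fieldType) (q : F) (A : unitAlgType F).
Hypothesis q0 : q != 0.
Implicit Types (a b c : A) (k l z : int).

Definition qcomm a b k := a * b = q ^ k *: (b * a).

Lemma qcomm1 a : qcomm a 1 0.
Proof. by rewrite /qcomm mulr1 mul1r expr0z scale1r. Qed.

Lemma qcommM a b c k l : qcomm a b k -> qcomm a c l -> qcomm a (b * c) (k + l).
Proof.
move=> ab ac; rewrite /qcomm mulrA ab -scalerAl -[b * a * c]mulrA ac -scalerAr scalerA.
by rewrite mulrA expfzDr.
Qed.

Lemma qcomm_sym a b k : qcomm a b k -> qcomm b a (- k).
Proof.
by move=> ab; rewrite /qcomm ab scalerA -expfzDr // addNr expr0z scale1r.
Qed.

Lemma qcommV a b k : b \is a GRing.unit -> qcomm a b k -> qcomm a b^-1 (- k).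
Proof.
move=> bU /qcomm_sym ba; rewrite /qcomm; apply: (mulrI bU); apply: (mulIr bU).
rewrite -scalerAr -scalerAl mulVKr // mulrA divrK //; exact: ba.
Qed.

Lemma qcommX a b k z :
  b \is a GRing.unit -> qcomm a b k -> qcomm a (b ^ z) (k * z).
Proof.
move=> bU ab.
have abn n : qcomm a (b ^+ n) (k * n%:Z).
  elim: n => [|n IHn]; first by rewrite mulr0; exact: qcomm1.
  by rewrite exprS intS mulrDr mulr1; exact: qcommM.
case: z => n; first exact: abn.
rewrite NegzE mulrN -invr_expz; apply: qcommV (abn _).
by rewrite unitrX.
Qed.

Lemma qcomm_prod (I : Type) (r : seq I) a (b : I -> A) (k : I -> int) :
  (forall i, qcomm a (b i) (k i)) ->
  qcomm a (\prod_(i <- r) b i) (\sum_(i <- r) k i).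
Proof.
move=> ab; elim/big_rec2: _ => [|i c l _ ac]; first exact: qcomm1.
exact: qcommM.
Qed.

(** Reordering the factors of a monomial costs a power of q, so identities between monomials are
    stated modulo this relation. *)
Definition qprop a b := exists k, a = q ^ k *: b.

Lemma qprop_refl a : qprop a a.
Proof. by exists 0; rewrite expr0z scale1r. Qed.

Lemma qprop_trans a b c : qprop a b -> qprop b c -> qprop a c.
Proof. by move=> [k ->] [l ->]; exists (k + l); rewrite scalerA expfzDr. Qed.

Lemma qprop_sym a b : qprop a b -> qprop b a.
Proof.
by move=> [k ->]; exists (- k); rewrite scalerA -expfzDr // addNr expr0z scale1r.
Qed.

Lemma qpropM a b a' b' : qprop a b -> qprop a' b' -> qprop (a * a') (b * b').
Proof.
move=> [k ->] [l ->]; exists (k + l).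
by rewrite -scalerAl -scalerAr scalerA expfzDr.
Qed.

Lemma qprop_prodM (I : Type) (r : seq I) (a b : I -> A) :
  (forall i j, exists k, qcomm (a i) (b j) k) ->
  qprop ((\prod_(i <- r) a i) * (\prod_(i <- r) b i)) (\prod_(i <- r) (a i * b i)).
Proof.
move=> ab; elim: r => [|i r IHr].
  by rewrite !big_nil mulr1; exact: qprop_refl.
have [k abk] := choice (fun j => ab j i).
have := @qcomm_prod _ r (b i) a (fun j => - k j) (fun j => qcomm_sym (abk j)).
move/qcomm_sym; move: (- _) => l abl.
rewrite !big_cons mulrA -[a i * _ * b i]mulrA abl -scalerAr -scalerAl.
apply: qprop_trans (_ : qprop _ (a i * b i * (\prod_(j <- r) a j * \prod_(j <- r) b j))) _.
  by exists l; rewrite !mulrA.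
by apply: qpropM => //; exact: qprop_refl.
Qed.

End QuasiCommutation.

(** * Ordered monomials, their weights and their span *)

Section QuasiMonomials.
Variables (F : fieldType) (q : F) (I : finType) (L : I -> I -> int).
Variables (A : unitAlgType F) (u : I -> A).
Hypotheses (q0 : q != 0) (uU : forall s, u s \is a GRing.unit).
Hypothesis uL : q_commuting q L u.
Implicit Types (a b : A) (m : {ffun I -> int}).

Definition mono m : A := \prod_s u s ^ m s.

Definition weight m s : int := \sum_t L s t * m t.

Lemma mono_unit m : mono m \is a GRing.unit.
Proof. by apply: rpred_prod => s _; exact: unitrXz. Qed.

Lemma mono0 : mono 0 = 1.
Proof. by rewrite /mono big1 // => s _; rewrite ffunE expr0z. Qed.

Lemma qcomm_mono s m : qcomm q (u s) (mono m) (weight m s).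
Proof. by apply: (qcomm_prod q0) => t; apply: qcommX => //; exact: uL. Qed.

Lemma monoD m m' : qprop q (mono m * mono m') (mono (m + m')).
Proof.
have -> : mono (m + m') = \prod_s (u s ^ m s * u s ^ m' s).
  by apply: eq_bigr => s _; rewrite ffunE exprzDr.
apply: qprop_prodM => // s t; eexists; apply: qcommX => //.
by apply: qcomm_sym => //; apply: qcommX => //; exact: uL.
Qed.

Definition qmono m a := qprop q a (mono m).

Lemma qmono_mono m : qmono m (mono m).
Proof. exact: qprop_refl. Qed.

Lemma qmono1 : qmono 0 1.
Proof. by rewrite -mono0; exact: qmono_mono. Qed.

Lemma qmonoM m m' a b : qmono m a -> qmono m' b -> qmono (m + m') (a * b).
Proof.
by move=> ma mb; apply: qprop_trans (monoD _ _) => //; exact: qpropM.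
Qed.

Lemma qmono_unit m a : qmono m a -> a \is a GRing.unit.
Proof.
by case=> k ->; rewrite scaler_unit ?mono_unit // unitfE expfz_neq0.
Qed.

Lemma qmonoV m a : qmono m a -> qmono (- m) a^-1.
Proof.
move=> ma; have [k e] := qmonoM ma (qmono_mono (- m)).
have aU := qmono_unit ma.
apply: qprop_sym => //; exists k; apply: (mulrI aU).
by rewrite e subrr mono0 -scalerAr divrr.
Qed.

Lemma qmonoX m a (z : int) : qmono m a -> qmono (m *~ z) (a ^ z).
Proof.
move=> ma.
have man n : qmono (m *+ n) (a ^+ n).
  elim: n => [|n IHn]; first by rewrite mulr0n; exact: qmono1.
  by rewrite exprS mulrS; exact: qmonoM.
case: z => n; first exact: man.
exact: qmonoV (man n.+1).
Qed.

Lemma qmono_prod (J : Type) (r : seq J) (m : J -> {ffun I -> int}) (a : J -> A) :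
  (forall j, qmono (m j) (a j)) ->
  qmono (\sum_(j <- r) m j) (\prod_(j <- r) a j).
Proof.
move=> ma; elim/big_rec2: _ => [|j b m' _ mb]; first exact: qmono1.
exact: qmonoM.
Qed.

Definition mono_delta s : {ffun I -> int} := [ffun t => (t == s)%:R].

Lemma mono_deltaE s : mono (mono_delta s) = u s.
Proof.
rewrite /mono -[RHS](big_pred1_eq *%R s u) [RHS]big_mkcond.
by apply: eq_bigr => t _; rewrite ffunE /=; case: eqP.
Qed.

Lemma qmono_gen s : qmono (mono_delta s) (u s).
Proof. rewrite -mono_deltaE; exact: qmono_mono. Qed.

Lemma qmono_comm m a s :
  qmono m a -> weight m s = 0 -> u s * a = a * u s.
Proof.
move=> [k ->] m0; have := qcomm_mono s m.
by rewrite /qcomm m0 expr0z scale1r -scalerAr -scalerAl => ->.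
Qed.

(** Boolean-valued through [asbool], since [subalg_closed] expects a predicate of this form. An
    exponent vector may occur several times in [l]. *)
Definition mono_span : {pred A} := fun a =>
  `[< exists l : seq (F * {ffun I -> int}), a = \sum_(p <- l) p.1 *: mono p.2 >].

Lemma mono_span_sum a (l : seq (F * {ffun I -> int})) :
  a = \sum_(p <- l) p.1 *: mono p.2 -> a \in mono_span.
Proof. by move=> ->; apply/asboolP; exists l. Qed.

Lemma mono_span_qmono m a : qmono m a -> a \in mono_span.
Proof.
by case=> k ->; apply: (mono_span_sum (l := [:: (q ^ k, m)])); rewrite big_seq1.
Qed.

Lemma mono_spanD a b : a \in mono_span -> b \in mono_span -> a + b \in mono_span.
Proof.
move=> /asboolP[l ->] /asboolP[l' ->]; apply: (mono_span_sum (l := l ++ l')).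
by rewrite big_cat.
Qed.

Lemma mono_spanZ c a : a \in mono_span -> c *: a \in mono_span.
Proof.
move=> /asboolP[l ->].
apply: (mono_span_sum (l := [seq (c * p.1, p.2) | p <- l])).
by rewrite big_map scaler_sumr; apply: eq_bigr => p _; rewrite scalerA.
Qed.

Lemma mono_span_closed : subalg_closed mono_span.
Proof.
split; first exact: mono_span_qmono qmono1.
  by move=> c a b sa sb; apply: mono_spanD => //; exact: mono_spanZ.
have span_sum (l : seq (F * {ffun I -> int})) (f : _ -> A) :
    (forall p, f p \in mono_span) -> \sum_(p <- l) f p \in mono_span.
  move=> sf; elim/big_ind: _ => // [|a b]; last exact: mono_spanD.
  by apply: (mono_span_sum (l := [::])); rewrite big_nil.
move=> _ _ /asboolP[l ->] /asboolP[l' ->].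
rewrite mulr_suml; apply: (span_sum) => p; rewrite mulr_sumr; apply: span_sum => p'.
rewrite -scalerAl -scalerAr; do 2!apply: mono_spanZ.
by apply: mono_span_qmono; apply: qmonoM; exact: qmono_mono.
Qed.

(* Conjugation by [u s] scales a monomial of weight [k] by [q ^ k] and fixes
   every central element, so [(q ^ k - conjugation) / (q ^ k - 1)] fixes [a] and
   kills its terms of weight [k]. *)
Lemma central_weight0 a :
  (forall k : int, k != 0 -> q ^ k != 1) -> central a -> a \in mono_span ->
  exists2 l : seq (F * {ffun I -> int}),
    forall p, p \in l -> forall s, weight p.2 s = 0 &
    a = \sum_(p <- l) p.1 *: mono p.2.
Proof.
move=> q_nroot a_central /asboolP[l].
(* Induction on the number of terms: each round removes all terms that have one chosen nonzero
   weight [k] at one chosen [s]. *)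
have [d] := ubnP (size l); elim: d l => // d IHd l /ltnSE le_l_d def_a.
have [/allP l0|] := boolP (all (fun p => [forall s, weight p.2 s == 0]) l).
  by exists l => // p /l0/forallP p0 s; apply/eqP.
rewrite -has_predC => /hasP[p lp /forallPn[s]].
set k := weight p.2 s => k0.
pose l' := [seq (((q ^ k - 1)^-1 * (q ^ k - q ^ weight p.2 s) * p.1), p.2)
  | p <- [seq p <- l | weight p.2 s != k]].
apply: (IHd l').
  rewrite size_map size_filter -(count_predC (fun p => weight p.2 s != k) l) in le_l_d *.
  apply: leq_trans le_l_d; rewrite -addn1 leq_add2l -has_count.
  by apply/hasP; exists p => //=; rewrite negbK.
have qk1 : q ^ k - 1 != 0 by rewrite subr_eq0 q_nroot.
have conj_a : a = \sum_(p <- l) q ^ weight p.2 s *: (p.1 *: mono p.2).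
  apply: (mulIr (uU s)); rewrite a_central def_a mulr_sumr mulr_suml.
  apply: eq_bigr => p' _; rewrite -scalerAr qcomm_mono -!scalerAl !scalerA.
  by rewrite mulrC.
apply: (scalerI qk1); rewrite scalerBl scale1r {2}conj_a def_a.
rewrite big_map big_filter !scaler_sumr -sumrB [RHS]big_mkcond /=.
apply: eq_bigr => p' _; case: eqP => [->|_] /=; first by rewrite subrr.
by rewrite !scalerA -!mulrA mulVKf // -scalerBl mulrBl.
Qed.

End QuasiMonomials.

Lemma presented_mono_span (F : fieldType) (q : F) (I : finType)
    (L : I -> I -> int) (A : unitAlgType F) (u : I -> A) :
  q != 0 -> presented (@laurent_rel F q I L) (laurent_gen u) ->
  [/\ forall s, u s \is a GRing.unit, q_commuting q L u &
      forall a, a \in mono_span u].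
Proof.
move=> q0 pres; have [[uV uL] _] := pres.
(* The formal inverse of a non-unit is a default value, so invertibility has to be read off the
   relations. *)
have uU s : u s \is a GRing.unit by apply/unitrP; exists (u s)^-1; case: (uV s).
split=> // a.
apply: (presented_subalg_full _ pres (mono_span_closed q0 uU uL)).
  by move=> B f h; exact: laurent_rel_inj.
case=> s; last exact: mono_span_qmono (qmonoV q0 uU uL (qmono_gen q u s)).
exact: mono_span_qmono (qmono_gen q u s).
Qed.

(** * Antiperiodic functions *)

Definition antiperiodic (N : nat) (f : nat -> int) :=
  forall k, f (k + N)%N = - f k.

Lemma antiperiodicMn N f (d k : nat) :
  antiperiodic N f -> f (k + d * N)%N = (-1) ^+ d * f k.
Proof.
move=> fN; elim: d => [|d IHd]; first by rewrite mul0n addn0 mul1r.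
by rewrite mulSnr addnA fN IHd exprS mulN1r mulNr.
Qed.

Lemma antiperiodic_eq0 N f :
  (0 < N)%N -> antiperiodic N f -> (forall k, (k < N)%N -> f k = 0) ->
  forall k, f k = 0.
Proof.
move=> N0 fN f0 k; rewrite (divn_eq k N) addnC antiperiodicMn //.
by rewrite f0 ?ltn_mod ?mulr0.
Qed.

Definition antiperiodic2 (n r : nat) (f : nat -> nat -> int) :=
  (forall a, antiperiodic r (f a)) /\ (forall j, antiperiodic n (f^~ j)).

Definition window (N : nat) (f : nat -> int) (j : nat) : int :=
  \sum_(1 <= k < N) f (j + k)%N.

(** Moving the window by one drops f(j + 1) and gains f(j + N) = - f(j). *)
Lemma windowS N f j :
  (0 < N)%N -> antiperiodic N f -> window N f j.+1 = window N f j - f j - f j.+1.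
Proof.
move=> N0 fN; apply: (addIr (- window N f j)); rewrite -sumrB.
rewrite (telescope_sumr_eq (fun k => f (j + k)%N)) //.
  by rewrite fN addn1; ring.
by move=> k _; rewrite addSn addnS.
Qed.

Lemma window_antiperiodic N M f :
  antiperiodic M f -> antiperiodic M (window N f).
Proof.
move=> fM k; rewrite /window -sumrN; apply: eq_bigr => i _.
by rewrite addnAC fM.
Qed.

Definition sgn_lt (j k : nat) : int := (j < k)%N%:R - (k < j)%N%:R.

(** By antiperiodicity the terms - f(k) with k < j are the values f(k + N), which continue the terms
    f(k) with j < k < N to one unsigned window after j. The induction on j shifts both sides by
    one. *)
Lemma window_sgn N f j : (j < N)%N -> antiperiodic N f ->
  \sum_(k < N) sgn_lt j k * f k = window N f j.
Proof.
move=> ltjN fN; elim: j ltjN => [|j IHj] ltjN.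
  rewrite /window -(big_mkord predT (fun k => sgn_lt 0 k * f k)).
  rewrite big_ltn // mul0r add0r big_nat_cond [RHS]big_nat_cond.
  apply: eq_bigr => k /andP[/andP[k0 _] _].
  by rewrite /sgn_lt k0 subr0 mul1r.
have N0 : (0 < N)%N by exact: leq_trans ltjN.
rewrite windowS // -IHj 1?ltnW //; apply/eqP; rewrite -subr_eq0; apply/eqP.
have -> : f j = \sum_(k < N) (k == j :> nat)%:R * f k.
  rewrite (bigD1 (Ordinal (ltnW ltjN))) //= eqxx mul1r big1 ?addr0 // => k.
  by rewrite -val_eqE /= => /negPf ->; rewrite mul0r.
have -> : f j.+1 = \sum_(k < N) (k == j.+1 :> nat)%:R * f k.
  rewrite (bigD1 (Ordinal ltjN)) //= eqxx mul1r big1 ?addr0 // => k.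
  by rewrite -val_eqE /= => /negPf ->; rewrite mul0r.
rewrite -!sumrB big1 // => k _; rewrite -!mulrBl.
suff -> : sgn_lt j.+1 k = sgn_lt j k - (k == j :> nat)%:R - (k == j.+1 :> nat)%:R.
  by rewrite subrr mul0r.
rewrite /sgn_lt; lia.
Qed.

Definition cross (n r : nat) (f : nat -> nat -> int) (a j : nat) : int :=
  window r (f a) j + window n (f^~ j) a.

(** By [windowS] the row and the column windows each contribute f(a, j) - f(a + 1, j + 1) to the
    mixed difference; their terms at (a, j + 1) and (a + 1, j) cancel. *)
Lemma cross_diff n r f a j :
  (0 < n)%N -> (0 < r)%N -> antiperiodic2 n r f ->
  cross n r f a j + cross n r f a.+1 j.+1 =
  cross n r f a.+1 j + cross n r f a j.+1 + 2 * (f a j - f a.+1 j.+1).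
Proof.
move=> n0 r0 [fr fn]; rewrite /cross !windowS //=.
by ring.
Qed.
Lemma cross_antiperiodic n r f :
  antiperiodic2 n r f -> antiperiodic2 n r (cross n r f).
Proof.
move=> [fr fn]; split=> [a j|j a]; rewrite /cross opprD.
  rewrite (window_antiperiodic _ (fr a)); congr (_ + _).
  by rewrite /window -sumrN; apply: eq_bigr => b _; exact: fr.
rewrite (window_antiperiodic _ (fn j)); congr (_ + _).
by rewrite /window -sumrN; apply: eq_bigr => k _; exact: fn.
Qed.

Definition diagonal (f : nat -> nat -> int) := forall a j, f a.+1 j.+1 = f a j.

Lemma diagonalD f a j d : diagonal f -> f (a + d)%N (j + d)%N = f a j.
Proof. by move=> fd; elim: d => [|d IHd]; rewrite ?addn0 // !addnS fd. Qed.

Lemma cross_eq0_diagonal n r f :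
  (0 < n)%N -> (0 < r)%N -> antiperiodic2 n r f ->
  (forall a j, (a < n)%N -> (j < r)%N -> cross n r f a j = 0) -> diagonal f.
Proof.
move=> n0 r0 f2 cf0 a j; have [cr cn] := cross_antiperiodic f2.
(* Vanishing on the n by r box spreads to all indices by antiperiodicity, so that the mixed
   difference can also be used at the edge of the box. *)
have {cr cn} cf0 b k : cross n r f b k = 0.
  move: b; apply: (antiperiodic_eq0 n0) (cn k) _ => b ltbn.
  by move: k; apply: (antiperiodic_eq0 r0) (cr b) _ => k; exact: cf0.
have := cross_diff a j n0 r0 f2; rewrite !cf0; lia.
Qed.

(** The mixed difference is zero, so the difference of two consecutive rows of [cross] does not
    depend on the column; having antiperiod r, it is zero. Thus [cross] is constant in the row
    index, and its antiperiod n makes it vanish. *)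
Lemma diagonal_cross_eq0 n r f a j :
  (0 < n)%N -> (0 < r)%N -> antiperiodic2 n r f -> diagonal f ->
  cross n r f a j = 0.
Proof.
move=> n0 r0 f2 fd; have [cr cn] := cross_antiperiodic f2.
have step b k : cross n r f b k + cross n r f b.+1 k.+1 =
    cross n r f b.+1 k + cross n r f b k.+1.
  by rewrite cross_diff // fd subrr mulr0 addr0.
have stepn b k d : cross n r f b k + cross n r f b.+1 (k + d) =
    cross n r f b.+1 k + cross n r f b (k + d).
  elim: d => [|d IHd]; first by rewrite addn0 addrC.
  have := step b (k + d)%N; rewrite !addnS; lra.
have c1 b k : cross n r f b.+1 k = cross n r f b k.
  have := stepn b k r; rewrite !cr; lia.
have c2 b k d : cross n r f (b + d)%N k = cross n r f b k.
  by elim: d => [|d IHd]; rewrite ?addn0 // addnS c1.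
have := c2 a j n; rewrite (cn j a); lia.
Qed.

(* Up to a diagonal move, going [s] columns to the right amounts to going [d * n]
   rows up and [b * r] columns to the left, where [d * n = b * r + s]; since [x]
   and [y] are odd, [d + b] is odd. *)
Lemma diagonal_antiperiodic_gcd n r s x y f :
  (0 < n)%N -> s = gcdn n r -> n = (x * s)%N -> r = (y * s)%N -> odd x -> odd y ->
  antiperiodic2 n r f -> diagonal f -> forall a, antiperiodic s (f a).
Proof.
move=> n0 hs hx hy ox oy [fr fn] fd a j.
have [d b def_d _] := egcdnP r n0.
have def_s : (d * n = b * r + s)%N by rewrite hs.
have s0 : (0 < s)%N by rewrite hs gcdn_gt0 n0.
have odd_db : odd (d + b).
  have : (d * x * s == (b * y + 1) * s)%N.
    by rewrite mulnDl mul1n -!mulnA -hx -hy def_s.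
  rewrite eqn_pmul2r // => /eqP/(congr1 odd).
  by rewrite oddM oddD oddM ox oy !andbT addbT oddD => ->; case: (odd b).
have def_j : (j + d * n = j + s + b * r)%N by rewrite def_s; lia.
have := diagonalD a j (d * n) fd; rewrite def_j antiperiodicMn //.
rewrite (antiperiodicMn _ _ (fn (j + s)%N)) mulrA -exprD addnC.
by rewrite -signr_odd odd_db mulN1r => <-; rewrite opprK.
Qed.

(** An odd multiple of an antiperiod is an antiperiod; for the rows, n steps down are traded along
    the diagonal for n steps to the left. *)
Lemma diagonal_antiperiodic2 n r s x y f :
  n = (x * s)%N -> r = (y * s)%N -> odd x -> odd y -> diagonal f ->
  (forall a, antiperiodic s (f a)) -> antiperiodic2 n r f.
Proof.
move=> -> -> ox oy fd fs; split=> [a j|j a].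
  by rewrite antiperiodicMn // -signr_odd oy mulN1r.
apply: oppr_inj; rewrite opprK -(diagonalD a j (x * s) fd) antiperiodicMn //.
by rewrite -signr_odd ox mulN1r.
Qed.

Definition antiext (n r : nat) (v : nat -> nat -> int) (a j : nat) : int :=
  (-1) ^+ (a %/ n + j %/ r) * v (a %% n)%N (j %% r)%N.

Lemma antiextE n r v a j :
  (a < n)%N -> (j < r)%N -> antiext n r v a j = v a j.
Proof. by move=> an jr; rewrite /antiext !divn_small ?modn_small // mul1r. Qed.

Lemma antiext_antiperiodic n r v :
  (0 < n)%N -> (0 < r)%N -> antiperiodic2 n r (antiext n r v).
Proof.
move=> n0 r0; split=> [a j|j a]; rewrite /antiext modnDr divnDr ?divnn ?dvdnn //.
  by rewrite r0 addnA addn1 exprS mulN1r mulNr.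
by rewrite n0 addn1 addSn exprS mulN1r mulNr.
Qed.

(** * The kernel of Lambda *)

(** The entry of TT: (b, k) is on the diagonal ray going down from (a, j). The equation on columns
    is written without subtraction. *)
Definition TT_coef (a j b k : nat) : int := ((a <= b) && (k + a == j + b))%N%:R.

(** H_S is the Kronecker sum of the skew matrices of sizes n and r, which is why it acts by a row
    window plus a column window. *)
Definition HS_coef (a j b k : nat) : int :=
  (a == b)%:R * sgn_lt j k + (j == k)%:R * sgn_lt a b.

Lemma shift_mxX r d (i j : 'I_r) :
  (shift_mx r ^+ d) i j = (j == i + d :> nat)%N%:R.
Proof.
elim: d i => [|d IHd] i; first by rewrite mxE addn0 eq_sym.
rewrite exprS mxE; have [lt_ir|le_ri] := ltnP i.+1 r.
  rewrite (bigD1 (Ordinal lt_ir)) //= big1 ?addr0 => [|k].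
    by rewrite mxE eqxx mul1r IHd addSnnS.
  by rewrite -val_eqE mxE /= => /negPf ->; rewrite mul0r.
rewrite big1 => [|k _]; last first.
  by rewrite mxE ltn_eqF ?mul0r // (leq_trans (ltn_ord k)).
by rewrite ltn_eqF // (leq_trans (ltn_ord j)) // (leq_trans le_ri) // addnS ltnS leq_addr.
Qed.

Lemma LambdaE n r (s t : 'I_n * 'I_r) :
  Lambda s t = \sum_(p : 'I_n * 'I_r) TT_coef p.1 p.2 s.1 s.2 *
    \sum_(p' : 'I_n * 'I_r) HS_coef p.1 p.2 p'.1 p'.2 * TT_coef p'.1 p'.2 t.1 t.2.
Proof.
have TTE (a b : 'I_n) (j k : 'I_r) :
    ((if (a <= b)%N then shift_mx r ^+ (b - a) else 0) : 'M_r) j k =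
    TT_coef a j b k.
  rewrite /TT_coef; case: leqP => ab; last by rewrite mxE.
  by rewrite shift_mxX /=; congr (_%:R); congr nat_of_bool; lia.
have HSE (a b : 'I_n) (j k : 'I_r) :
    ((if a == b then skew_mx r else if (a < b)%N then 1%:M else - 1%:M) : 'M_r)
      j k = HS_coef a j b k.
  rewrite /HS_coef /sgn_lt -val_eqE /=; case: ltngtP => ab; rewrite !mxE -?val_eqE /=.
  - by rewrite mul0r add0r subr0 mulr1.
  - by rewrite mul0r !add0r mulrN1.
  - by rewrite subrr mulr0 addr0 mul1r.
rewrite /Lambda /Lambda_mx /TT_mx /HS_mx tr_mxblock !mul_mxblock mxblockK.
transitivity (\sum_(p' : 'I_n * 'I_r)
  (\sum_(p : 'I_n * 'I_r) TT_coef p.1 p.2 s.1 s.2 * HS_coef p.1 p.2 p'.1 p'.2) *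
  TT_coef p'.1 p'.2 t.1 t.2).
  rewrite -[RHS](pair_bigA _ (fun (b : 'I_n) (k : 'I_r) =>
    (\sum_(p : 'I_n * 'I_r) TT_coef p.1 p.2 s.1 s.2 * HS_coef p.1 p.2 b k) *
    TT_coef b k t.1 t.2)) summxE.
  apply: eq_bigr => b _; rewrite mxE; apply: eq_bigr => k _; rewrite TTE.
  congr (_ * _); rewrite -[RHS](pair_bigA _ (fun (a : 'I_n) (j : 'I_r) =>
    TT_coef a j s.1 s.2 * HS_coef a j b k)) summxE.
  apply: eq_bigr => a _; rewrite mxE; apply: eq_bigr => j _.
  by rewrite HSE mxE TTE.
under eq_bigr => p' _ do rewrite mulr_suml.
rewrite exchange_big; apply: eq_bigr => p _; rewrite mulr_sumr.
by apply: eq_bigr => p' _; rewrite mulrA.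
Qed.

(** The vector TT m, with indices in [nat]: it is zero beyond the box, so the recursion along
    diagonals also holds in the last row and column. *)
Definition TT_apply (n r : nat) (m : {ffun 'I_n * 'I_r -> int}) (a j : nat) : int :=
  \sum_(t : 'I_n * 'I_r) TT_coef a j t.1 t.2 * m t.

Lemma TT_apply_out n r (m : {ffun 'I_n * 'I_r -> int}) a j :
  (n <= a)%N || (r <= j)%N -> TT_apply m a j = 0.
Proof.
move=> out; rewrite /TT_apply big1 // => -[b k] _.
have ltbn := ltn_ord b; have ltkr := ltn_ord k.
rewrite /TT_coef /=; case: andP => [[? /eqP ?]|]; last by rewrite mul0r.
by exfalso; lia.
Qed.

Lemma sum_pair_eq n r (F : 'I_n * 'I_r -> int) (p : 'I_n * 'I_r) :
  \sum_(t : 'I_n * 'I_r) ((p.1 == t.1 :> nat) && (p.2 == t.2 :> nat))%:R * F t = F p.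
Proof.
rewrite (bigD1 p) //= !eqxx mul1r big1 ?addr0 // => t.
rewrite -pair_eqE /pair_eq -!val_eqE /= ![nat_of_ord t.1 == _]eq_sym.
by rewrite ![nat_of_ord t.2 == _]eq_sym => /negPf ->; rewrite mul0r.
Qed.

(** TT is the sum of the powers of the diagonal shift, hence the inverse of one minus that shift. *)
Lemma TT_applyE n r (m : {ffun 'I_n * 'I_r -> int}) (p : 'I_n * 'I_r) :
  TT_apply m p.1 p.2 = m p + TT_apply m p.1.+1 p.2.+1.
Proof.
rewrite -(sum_pair_eq m) -big_split /=; apply: eq_bigr => t _.
rewrite -mulrDl; congr (_ * _); rewrite /TT_coef; lia.
Qed.

(** The transpose of TT sums z up the diagonals: an entry of z is the difference of two consecutive
    sums, and in the first row or column the sum consists of that entry alone. *)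
Lemma TT_tr_inj n r (z : 'I_n * 'I_r -> int) :
  (forall s : 'I_n * 'I_r, \sum_(p : 'I_n * 'I_r) TT_coef p.1 p.2 s.1 s.2 * z p = 0) ->
  forall p, z p = 0.
Proof.
move=> Wz [a j].
have split_z b k : \sum_(p : 'I_n * 'I_r) TT_coef p.1 p.2 b.+1 k.+1 * z p =
  \sum_(p : 'I_n * 'I_r)
    ((b.+1 == p.1 :> nat) && (k.+1 == p.2 :> nat))%:R * z p +
  \sum_(p : 'I_n * 'I_r) TT_coef p.1 p.2 b k * z p.
  rewrite -big_split /=; apply: eq_bigr => t _.
  by rewrite -mulrDl; congr (_ * _); rewrite /TT_coef; lia.
have z_border : (a == 0 :> nat) || (j == 0 :> nat) -> z (a, j) = 0.
  move=> border; rewrite -(sum_pair_eq z) -[RHS](Wz (a, j)).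
  by apply: eq_bigr => t _; congr (_ * _); rewrite /TT_coef /=; lia.
case: a j Wz z_border => [[|a] lta] [[|j] ltj] Wz zb; try exact: zb.
have := split_z a j.
rewrite (Wz (Ordinal lta, Ordinal ltj)) (Wz (Ordinal (ltnW lta), Ordinal (ltnW ltj))).
by rewrite addr0 -(sum_pair_eq z) => <-.
Qed.

Lemma HS_apply n r f (p : 'I_n * 'I_r) : antiperiodic2 n r f ->
  \sum_(p' : 'I_n * 'I_r) HS_coef p.1 p.2 p'.1 p'.2 * f p'.1 p'.2 =
  cross n r f p.1 p.2.
Proof.
case: p => a j [fr fn] /=.
rewrite -(pair_bigA _ (fun (b : 'I_n) (k : 'I_r) => HS_coef a j b k * f b k)) /=.
rewrite /cross -!window_sgn //.
under eq_bigr => b _ do under eq_bigr => k _ do rewrite /HS_coef mulrDl.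
under eq_bigr => b _ do rewrite big_split /=.
rewrite big_split /=; congr (_ + _).
  rewrite (bigD1 a) //= [X in _ + X]big1 ?addr0 => [|b].
    by apply: eq_bigr => k _; rewrite eqxx mul1r.
  rewrite -val_eqE eq_sym /= => /negPf ->.
  by rewrite big1 // => k _; rewrite !mul0r.
apply: eq_bigr => b _; rewrite (bigD1 j) //= eqxx mul1r big1 ?addr0 // => k.
by rewrite -val_eqE eq_sym /= => /negPf ->; rewrite !mul0r.
Qed.

(** Here f is any antiperiodic extension of TT m; [cross] of f is then H_S TT m on the box, and the
    outer sum applies the transpose of TT. *)
Lemma Lambda_weight n r (m : {ffun 'I_n * 'I_r -> int}) (s : 'I_n * 'I_r) f :
  antiperiodic2 n r f ->
  (forall a j, (a < n)%N -> (j < r)%N -> f a j = TT_apply m a j) ->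
  weight (@Lambda n r) m s =
  \sum_(p : 'I_n * 'I_r) TT_coef p.1 p.2 s.1 s.2 * cross n r f p.1 p.2.
Proof.
move=> f2 fE; rewrite /weight.
under eq_bigr => t _ do rewrite LambdaE mulr_suml.
rewrite exchange_big /=; apply: eq_bigr => p _.
under eq_bigr => t _ do rewrite -mulrA.
rewrite -mulr_sumr -HS_apply //; congr (_ * _).
under eq_bigr => t _ do rewrite mulr_suml.
rewrite exchange_big /=; apply: eq_bigr => p' _.
rewrite fE // mulr_sumr.
by apply: eq_bigr => t _; rewrite mulrA.
Qed.

(** For diagonal f, the preimage under TT of f restricted to the box: differences along diagonals
    survive only where the next point leaves the box. *)
Definition border (n r : nat) (f : nat -> nat -> int) : {ffun 'I_n * 'I_r -> int} :=
  [ffun t : 'I_n * 'I_r => if (t.1.+1 == n) || (t.2.+1 == r) then f t.1 t.2 else 0].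

Lemma TT_apply_border n r f a j :
  diagonal f -> (a < n)%N -> (j < r)%N -> TT_apply (border n r f) a j = f a j.
Proof.
move=> fd; have [d] := ubnP (n - a); elim: d a j => // d IHd a j le_d ltan ltjr.
have := TT_applyE (border n r f) (Ordinal ltan, Ordinal ltjr).
rewrite /= ffunE /= => ->; case: ifP => [out|/norP[out1 out2]].
  by rewrite TT_apply_out ?addr0 //; lia.
by rewrite add0r IHd ?fd //; lia.
Qed.

Lemma kernel_border n r s x y (m : {ffun 'I_n * 'I_r -> int}) :
  (0 < n)%N -> (0 < r)%N ->
  s = gcdn n r -> n = (x * s)%N -> r = (y * s)%N -> odd x -> odd y ->
  (forall t, weight (@Lambda n r) m t = 0) ->
  exists f, [/\ diagonal f, forall a, antiperiodic s (f a) & m = border n r f].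
Proof.
move=> n0 r0 hs hx hy ox oy m0.
pose f := antiext n r (TT_apply m).
have f2 : antiperiodic2 n r f by exact: antiext_antiperiodic.
have fE a j : (a < n)%N -> (j < r)%N -> f a j = TT_apply m a j by exact: antiextE.
have fd : diagonal f.
  apply: (cross_eq0_diagonal n0 r0 f2) => a j lta ltj.
  apply: (TT_tr_inj (z := fun p => cross n r f p.1 p.2) _
    (Ordinal lta, Ordinal ltj)) => t.
  by rewrite -(Lambda_weight _ f2 fE).
exists f; split=> //; first exact: (diagonal_antiperiodic_gcd n0 hs hx hy ox oy f2 fd).
apply/ffunP => p; rewrite ffunE.
have [lt1 lt2] := (ltn_ord p.1, ltn_ord p.2).
have := TT_applyE m p; rewrite -fE //; case: ifP => [out|/norP[out1 out2]].
  by rewrite TT_apply_out ?addr0 => [->|] //; lia.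
rewrite -fE ?fd => [e||]; [|by rewrite ltn_neqAle out1|by rewrite ltn_neqAle out2].
by apply: (addIr (f p.1 p.2)); rewrite add0r -e.
Qed.

Lemma border_kernel n r s x y f (t : 'I_n * 'I_r) :
  (0 < n)%N -> (0 < r)%N ->
  n = (x * s)%N -> r = (y * s)%N -> odd x -> odd y ->
  diagonal f -> (forall a, antiperiodic s (f a)) ->
  weight (@Lambda n r) (border n r f) t = 0.
Proof.
move=> n0 r0 hx hy ox oy fd fs.
have f2 : antiperiodic2 n r f by exact: (diagonal_antiperiodic2 hx hy ox oy fd fs).
rewrite (Lambda_weight t f2) => [|a j lta ltj]; last by rewrite TT_apply_border.
by rewrite big1 // => p _; rewrite diagonal_cross_eq0 // mulr0.
Qed.

(** * Generators of the center *)

(** The zero vector when (a, j) is out of range, in accordance with the value 1 of [entry] there, in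
    particular for a = 0. *)
Definition entry_exp (n r a j : nat) : {ffun 'I_n * 'I_r -> int} :=
  [ffun t : 'I_n * 'I_r => ((t.1.+1 == a) && (t.2.+1 == j))%:R].

Lemma qmono_entry (F : fieldType) (q : F) (n r : nat) (A : unitAlgType F)
    (u : 'I_n * 'I_r -> A) a j :
  qmono q u (entry_exp n r a j) (entry u a j).
Proof.
have out : (forall t : 'I_n * 'I_r, ~~ ((t.1.+1 == a) && (t.2.+1 == j))) ->
    qmono q u (entry_exp n r a j) 1.
  move=> out; suff -> : entry_exp n r a j = 0 by exact: qmono1.
  by apply/ffunP => t; rewrite !ffunE (negPf (out t)).
case: a out => [|a] out; first exact: out.
case: j out => [|j] out; first by apply: out => t; rewrite andbF.
rewrite /=; case: insubP => [a0 _ def_a|na]; last first.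
  apply: out => t; apply: contra na => /andP[/eqP[<-] _]; exact: ltn_ord.
case: insubP => [j0 _ def_j|nj]; last first.
  apply: out => t; apply: contra nj => /andP[_ /eqP[<-]]; exact: ltn_ord.
suff -> : entry_exp n r a.+1 j.+1 = mono_delta (a0, j0) by exact: qmono_gen.
apply/ffunP => t; rewrite !ffunE -pair_eqE /pair_eq -!val_eqE /=.
by rewrite !eqSS -def_a -def_j.
Qed.

Definition center_exp (n r s x y i : nat) : {ffun 'I_n * 'I_r -> int} :=
  \sum_(0 <= l < y) entry_exp n r n (i + l * s) *~ (-1) ^+ l +
  \sum_(0 <= k < x) entry_exp n r (n - i - k * s) r *~ (-1) ^+ k.+1.

Lemma qmono_center_gen (F : fieldType) (q : F) (n r s x y : nat)
    (L : 'I_n * 'I_r -> 'I_n * 'I_r -> int) (A : unitAlgType F)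
    (u : 'I_n * 'I_r -> A) i :
  q != 0 -> (forall t, u t \is a GRing.unit) -> q_commuting q L u ->
  qmono q u (center_exp n r s x y i) (center_gen s x y u i).
Proof.
move=> q0 uU uL; apply: (qmonoM q0 uU uL); apply: (qmono_prod q0 uU uL) => k;
  by apply: (qmonoX q0 uU uL); exact: qmono_entry.
Qed.

Lemma ffunMzE (I : finType) (m : {ffun I -> int}) (z : int) t :
  (m *~ z) t = m t * z.
Proof.
have nE k : (m *+ k) t = m t * k%:Z by rewrite ffunMnE -mulr_natr natz.
by case: z => k; [exact: nE | rewrite NegzE mulrN -nE /= ffunE].
Qed.

(** By Euclidean division, i + l s takes each value below y s exactly once. *)
Lemma sum_arith (V : nmodType) (s y : nat) (f : nat -> V) :
  \sum_(0 <= i < s) \sum_(0 <= l < y) f (i + l * s)%N = \sum_(0 <= j < y * s) f j.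
Proof.
rewrite exchange_big big_nat_mul; apply: eq_bigr => l _ /=.
by rewrite -{2}[(l * s)%N]add0n big_addn mulSn addnK.
Qed.

Lemma sum_nat_eq (N : nat) (f : nat -> int) j :
  \sum_(0 <= i < N) f i * (i == j)%:R = if (j < N)%N then f j else 0.
Proof.
rewrite big_mkord; case: ltnP => [ltjN|leNj].
  rewrite (bigD1 (Ordinal ltjN)) //= eqxx mulr1 big1 ?addr0 // => i.
  by rewrite -val_eqE /= => /negPf ->; rewrite mulr0.
rewrite big1 // => i _; rewrite ltn_eqF ?mulr0 //; exact: leq_trans leNj.
Qed.

(** The antiperiod s absorbs the signs, so summing over i and l (or k) gives one sum along the last
    row and one along the last column. The column values agree since f(n - 2 - j, r - 1) = f(n - 1,
    j + r) = - f(n - 1, j). *)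
Lemma border_center_exp n r s x y f :
  (0 < n)%N -> (0 < r)%N ->
  n = (x * s)%N -> r = (y * s)%N -> odd x -> odd y ->
  diagonal f -> (forall a, antiperiodic s (f a)) ->
  border n r f =
  \sum_(0 <= i < s) center_exp n r s x y i.+1 *~ f n.-1 i.
Proof.
move=> n0 r0 hx hy ox oy fd fs; apply/ffunP => -[b d].
have [lt1 lt2] := (ltn_ord b, ltn_ord d).
have [fr _] := diagonal_antiperiodic2 hx hy ox oy fd fs.
rewrite sum_ffunE ffunE /=.
(* [g] collects the last row, corner included; [h] collects the last column from row n - 1 upwards
   in 1-based numbering, and its index j = n - 1 gives row 0, which contributes nothing. *)
pose g j := f n.-1 j * (j == d)%:R * (b.+1 == n)%:R.
pose h j := - (f n.-1 j * (b.+1 == n - j.+1)%N%:R * (d.+1 == r)%:R).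
transitivity (\sum_(0 <= j < r) g j + \sum_(0 <= j < n) h j); last first.
  have -> : \sum_(0 <= j < r) g j = \sum_(0 <= i < s) \sum_(0 <= l < y) g (i + l * s)%N.
    by rewrite sum_arith -hy.
  have -> : \sum_(0 <= j < n) h j = \sum_(0 <= i < s) \sum_(0 <= k < x) h (i + k * s)%N.
    by rewrite sum_arith -hx.
  rewrite -big_split /=; apply: eq_bigr => i _.
  rewrite ffunMzE !ffunE !sum_ffunE mulrDl !mulr_suml; congr (_ + _).
    apply: eq_bigr => l _; rewrite ffunMzE ffunE /g antiperiodicMn //.
    rewrite addSn eqSS [_ == (i + _)%N]eq_sym -mulnb natrM; ring.
  apply: eq_bigr => k _; rewrite ffunMzE ffunE /h antiperiodicMn //.
  by rewrite -subnDA addSn -mulnb natrM exprS; ring.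
rewrite -mulr_suml sum_nat_eq lt2 sumrN -mulr_suml.
have -> : \sum_(0 <= i < n) f n.-1 i * (b.+1 == n - i.+1)%N%:R =
    if (b.+1 < n)%N then f n.-1 (n - b.+2)%N else 0.
  case: ltnP => [lt1n|le_n]; last first.
    by rewrite big_nat big1 // => i lti; rewrite (_ : _ == _ = false) ?mulr0 //; lia.
  transitivity (\sum_(0 <= i < n) f n.-1 i * (i == n - b.+2)%N%:R).
    rewrite big_nat [RHS]big_nat; apply: eq_bigr => i lti.
    by congr (_ * _%:R); congr nat_of_bool; lia.
  by rewrite sum_nat_eq; case: ifP => //; lia.
have [e1|ne1] := eqVneq b.+1 n.
  by rewrite ltn_neqAle e1 eqxx /= mul0r subr0 mulr1 -[n.-1]/n.-1 -(congr1 predn e1).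
rewrite mulr0 add0r /=; have lt1n : (b.+1 < n)%N by rewrite ltn_neqAle ne1.
rewrite lt1n; have [e2|ne2] := eqVneq d.+1 r; last by rewrite mulr0 oppr0.
(* Slide down the diagonal from (b, r - 1) to the last row; the column passes r and the sign
   changes. *)
rewrite mulr1 -fr -(diagonalD b d (n - b.+1) fd).
by congr (f _ _); lia.
Qed.

Definition comb (s i k : nat) : int := (-1) ^+ (k %/ s) * (k %% s == i)%N%:R.

Lemma comb_antiperiodic s i : (0 < s)%N -> antiperiodic s (comb s i).
Proof.
move=> s0 k; rewrite /comb modnDr divnDr ?dvdnn // divnn s0 addn1.
by rewrite exprS mulN1r mulNr.
Qed.

(* [comb s i] has period [2 * s], so this is [comb s i (j - a + n - 1)]. *)
Definition spike (n s i a j : nat) : int :=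
  comb s i (j + (2 * s).-1 * (a + (2 * s).-1 * n.-1)).

Lemma spike_antiperiodic n s i a : (0 < s)%N -> antiperiodic s (spike n s i a).
Proof. by move=> s0 j; rewrite /spike addnAC comb_antiperiodic. Qed.

Lemma spike_diagonal n s i : (0 < s)%N -> diagonal (spike n s i).
Proof.
move=> s0 a j; rewrite /spike.
(* One step down the diagonal adds 1 + (2s - 1) = 2s to the argument, a full period. *)
set k := (j + _)%N; rewrite (_ : (j.+1 + _ = k + 2 * s)%N); last by rewrite /k; nia.
by rewrite antiperiodicMn ?mul1r //; exact: comb_antiperiodic.
Qed.

Lemma spike_last_row n s i j : (0 < s)%N -> (j < s)%N ->
  spike n s i n.-1 j = (j == i)%:R.
Proof.
move=> s0 ltjs; rewrite /spike.
(* With a = n - 1 the added term is (2s - 1)(n - 1)(1 + 2s - 1), an even multiple of s. *)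
rewrite (_ : (j + _ = j + (2 * ((2 * s).-1 * n.-1)) * s)%N); last by nia.
rewrite antiperiodicMn; last exact: comb_antiperiodic.
by rewrite exprM sqrrN !expr1n mul1r /comb divn_small ?modn_small // mul1r.
Qed.

(** Expanding the border of a spike over the generators leaves one term, as its values on the last
    row are Kronecker deltas. This puts the exponents of each generator in the kernel of Lambda. *)
Lemma center_exp_border n r s x y i :
  (0 < n)%N -> (0 < r)%N -> (i < s)%N ->
  n = (x * s)%N -> r = (y * s)%N -> odd x -> odd y ->
  center_exp n r s x y i.+1 = border n r (spike n s i).
Proof.
move=> n0 r0 ltis hx hy ox oy.
have s0 : (0 < s)%N by exact: leq_trans ltis.
rewrite (border_center_exp n0 r0 hx hy ox oy (spike_diagonal n i s0)) => [|a];
  last exact: spike_antiperiodic.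
rewrite big_mkord (bigD1 (Ordinal ltis)) //= spike_last_row // eqxx mulr1z.
rewrite big1 ?addr0 // => j; rewrite -val_eqE /= => /negPf ne.
by rewrite spike_last_row // ne mulr0z.
Qed.

(** * Monomials of weight zero are central; description of the center *)

Lemma central_mono_span (F : fieldType) (q : F) (I : finType) (L : I -> I -> int)
    (A : unitAlgType F) (u : I -> A) m a :
  q != 0 -> (forall t, u t \is a GRing.unit) -> q_commuting q L u ->
  (forall b, b \in mono_span u) ->
  qmono q u m a -> (forall s, weight L m s = 0) -> central a.
Proof.
move=> q0 uU uL uspan ma m0 b; have /asboolP[l ->] := uspan b.
rewrite mulr_sumr mulr_suml; apply: eq_bigr => p _.
rewrite -scalerAl -scalerAr; congr (_ *: _).
have au s : qcomm q a (u s ^ p.2 s) (0 * p.2 s).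
  apply: (qcommX q0 _ (uU s)); rewrite /qcomm expr0z scale1r.
  by rewrite (qmono_comm q0 uU uL ma).
have := qcomm_prod q0 (index_enum I) au.
rewrite [X in qcomm _ _ _ X]big1 => [|s _]; last exact: mul0r.
by rewrite /qcomm expr0z scale1r.
Qed.

Lemma centralV (A : unitRingType) (a : A) : central a -> central a^-1.
Proof. by move=> ca b; apply/esym/commrV/esym/ca. Qed.

Lemma gen_subalgX (F : fieldType) (A : unitAlgType F) (S : A -> Prop) a (z : int) :
  gen_subalg S a -> gen_subalg S a^-1 -> gen_subalg S (a ^ z).
Proof.
move=> Sa SVa.
have SX b n : gen_subalg S b -> gen_subalg S (b ^+ n).
  move=> Sb; elim: n => [|n IHn]; first exact: GenOne.
  by rewrite exprS; exact: GenMul.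
by case: z => n; rewrite ?NegzE -?exprz_inv; exact: SX.
Qed.

Lemma gen_subalg_sum (F : fieldType) (A : algType F) (S : A -> Prop)
    (I : eqType) (l : seq I) (a : I -> A) :
  (forall i, i \in l -> gen_subalg S (a i)) -> gen_subalg S (\sum_(i <- l) a i).
Proof.
move=> Sa; rewrite big_seq; elim/big_ind: _ => // [|b c]; last exact: GenAdd.
(* The empty sum is obtained as 0 times the unit. *)
by rewrite -(scale0r 1); apply: GenScale; exact: GenOne.
Qed.

Lemma expz_neq1 (F : fieldType) (q : F) :
  q != 0 -> (forall m : nat, (0 < m)%N -> q ^+ m != 1) ->
  forall k : int, k != 0 -> q ^ k != 1.
Proof.
move=> q0 hq [[|k]|k] // _; first exact: hq.
by rewrite NegzE -invr_expz -invr1 (inj_eq invr_inj); exact: hq.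
Qed.

Theorem proposition5p5 (R : realType) (q : R[i]) (n r s x y : nat)
  (hn : (0 < n)%N) (hr : (0 < r)%N)
  (hq0 : q != 0) (hq : forall m : nat, (0 < m)%N -> q ^+ m != 1)
  (hnr : (n <= r)%N) (hs : s = gcdn n r)
  (hx : n = (x * s)%N) (hy : r = (y * s)%N) (ox : odd x) (oy : odd y)
  (O : algType R[i]) (Z : 'I_n * 'I_r -> O) (hO : is_FRT q Z)
  (A : unitAlgType R[i]) (u : 'I_n * 'I_r -> A)
  (hA : quasi_Laurent q (@Lambda n r) (xi q Z) u) :
  forall a : A,
    central a <->
    gen_subalg (fun c : A => exists i : nat, (1 <= i <= s)%N /\
      (c = center_gen s x y u i \/ c = (center_gen s x y u i)^-1)) a.
Proof.
have [uU uL uspan] := presented_mono_span hq0 (quasi_Laurent_pres hA).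
have s0 : (0 < s)%N by rewrite hs gcdn_gt0 hn.
have qmC i := qmono_center_gen s x y i hq0 uU uL.
move=> a; split=> [ca|].
  have [l l0 ->] := central_weight0 hq0 uU uL (expz_neq1 hq0 hq) ca (uspan a).
  apply: gen_subalg_sum => p /l0 p0; apply: GenScale.
  have [f [fd fs ->]] := kernel_border hn hr hs hx hy ox oy p0.
  rewrite (border_center_exp hn hr hx hy ox oy fd fs) big_mkord.
  (* The product of the powers f(n - 1, i) of the generators has this exponent vector, so it is the
     monomial up to a power of q. *)
  have /(qprop_sym hq0)[k ->] := qmono_prod hq0 uU uL (index_enum 'I_s)
    (fun i : 'I_s => qmonoX hq0 uU uL (f n.-1 i) (qmC i.+1)).
  apply: GenScale; elim/big_ind: _ => [|b c|i _]; [exact: GenOne|exact: GenMul|].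
  by apply: gen_subalgX; apply: GenIn; exists i.+1;
    (split; [exact: ltn_ord | by [left | right]]).
(* Conversely, centrality passes through sums, products and scalars; only the generators, whose
   exponents are borders of spikes, need an argument. *)
elim=> {a} [c [[|i] [// ltis Cc]]| |a b _ ca _ cb|a b _ ca _ cb|k a _ ca] b'.
- have cC : central (center_gen s x y u i.+1).
    apply: (central_mono_span hq0 uU uL uspan (qmC i.+1)) => t.
    rewrite center_exp_border //; apply: (border_kernel t hn hr hx hy ox oy).
      exact: spike_diagonal.
    by move=> a; exact: spike_antiperiodic.
  by case: Cc => ->; [exact: cC | exact: centralV].
- by rewrite mul1r mulr1.
- by rewrite mulrDl mulrDr ca cb.
- by rewrite -mulrA cb mulrA ca mulrA.
- by rewrite -scalerAl -scalerAr ca.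
Qed.
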